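(* Let $m\ge n\ge2$ be integers with $(m,n)\neq(2,2)$, let $G_{m,n}=\langle x,y \mid x^m=y^n\rangle$, and let $<_D$ be the Dehornoy-like ordering of $G_{m,n}$ defined by the ordered generating set $\mathcal{S}=\{s_1=xyx^{-m+1},\ s_2=x^{m-1}y^{-1}\}$. Then $g<_D s_2g$ holds for all $g\in G_{m,n}$.
   Context: Dehornoy-like ordering: $<_D$ is the left ordering of $G_{m,n}$ (total order invariant under left multiplication) whose positive cone $\{g: 1<_D g\}$ is the set of elements represented either by a word on $s_1,s_2^{\pm1}$ containing at least one $s_1$ and no $s_1^{-1}$, or by $s_2^k$ with $k\ge1$. It is known that this set is indeed the positive cone of a left ordering. *)

(* Defs.v *)
From HB Require Import structures.
From mathcomp Require Import all_boot.
From mathcomp Require Import boolp.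

Set Implicit Arguments.
Unset Strict Implicit.
Unset Printing Implicit Defensive.

Local Open Scope group_scope.
Local Open Scope quotient_scope.

(* The letter (a, false) stands for a, and (a, true) for the inverse of a. *)
Definition word (S : Type) := seq (S * bool).

Definition linv (S : Type) (a : S * bool) : S * bool := (a.1, ~~ a.2).

Definition winv (S : Type) (w : word S) : word S := rev (map (@linv S) w).

Definition weval (S : Type) (G : groupType) (f : S -> G) (w : word S) : G :=
  \prod_(a <- w) (if a.2 then (f a.1)^-1 else f a.1).

Section Presentation.

Variables (S : choiceType) (R : word S -> word S -> Prop).

(* The least congruence on words containing free cancellation and R. *)
Inductive wcong : word S -> word S -> Prop :=
| wcong_rel u v : R u v -> wcong u v
| wcong_cancel a : wcong [:: a; linv a] [::]
| wcong_cat u u' v v' : wcong u u' -> wcong v v' -> wcong (u ++ v) (u' ++ v')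
| wcong_refl u : wcong u u
| wcong_sym u v : wcong u v -> wcong v u
| wcong_trans v u w : wcong u v -> wcong v w -> wcong u w.

Definition wcongb : rel (word S) := fun u v => `[< wcong u v >].

Lemma wcongb_refl : reflexive wcongb.
Proof. by move=> u; apply/asboolP; apply: wcong_refl. Qed.

Lemma wcongb_sym : symmetric wcongb.
Proof. by move=> u v; apply/asboolP/asboolP; apply: wcong_sym. Qed.

Lemma wcongb_trans : transitive wcongb.
Proof.
by move=> v u w /asboolP uv /asboolP vw; apply/asboolP; apply: wcong_trans vw.
Qed.

Canonical wcongb_equiv := EquivRel wcongb wcongb_refl wcongb_sym wcongb_trans.

Definition presented : Type := {eq_quot wcongb}.

HB.instance Definition _ := Choice.on presented.
HB.instance Definition _ := EqQuotient.on presented.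

Definition pclass (w : word S) : presented := \pi_presented w.

Lemma pclassP u v : pclass u = pclass v <-> wcong u v.
Proof.
rewrite /pclass; split=> [/eqP|uv]; first by rewrite piE => /asboolP.
by apply/eqP; rewrite piE; apply/asboolP.
Qed.

Lemma reprP u : wcong (repr (pclass u)) u.
Proof. by apply/pclassP; rewrite /pclass reprK. Qed.

Lemma pclassK (g : presented) : pclass (repr g) = g.
Proof. exact: reprK. Qed.

Lemma linvK : involutive (@linv S).
Proof. by case=> a b; rewrite /linv /= negbK. Qed.

Lemma winvK : involutive (@winv S).
Proof. by move=> u; rewrite /winv map_rev revK (mapK linvK). Qed.

Lemma wcong_mulV u : wcong (u ++ winv u) [::].
Proof.
elim: u => [|a u IHu]; first exact: wcong_refl.
rewrite /winv /= rev_cons -cats1 catA -cat1s -catA.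
apply: (@wcong_trans ([:: a] ++ [:: linv a])); last exact: wcong_cancel.
apply: wcong_cat; first exact: wcong_refl.
by rewrite catA; apply: (wcong_cat IHu (wcong_refl [:: linv a])).
Qed.

Lemma wcong_mulVl u : wcong (winv u ++ u) [::].
Proof. by rewrite -{2}[u]winvK; apply: wcong_mulV. Qed.

Lemma wcong_inv u v : wcong u v -> wcong (winv u) (winv v).
Proof.
move=> uv; apply: (@wcong_trans (winv u ++ (v ++ winv v))).
  rewrite -{1}[winv u]cats0; apply: wcong_cat; first exact: wcong_refl.
  exact/wcong_sym/wcong_mulV.
rewrite catA -{2}[winv v]cat0s; apply: wcong_cat; last exact: wcong_refl.
apply: wcong_trans (wcong_mulVl u); apply: wcong_cat; first exact: wcong_refl.
exact: wcong_sym.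
Qed.

Definition pone : presented := pclass [::].
Definition pmul (g h : presented) : presented := pclass (repr g ++ repr h).
Definition pinv (g : presented) : presented := pclass (winv (repr g)).

Lemma pmulE u v : pmul (pclass u) (pclass v) = pclass (u ++ v).
Proof. by apply/pclassP; apply: wcong_cat; apply: reprP. Qed.

Lemma pinvE u : pinv (pclass u) = pclass (winv u).
Proof. by apply/pclassP; apply: wcong_inv; apply: reprP. Qed.

Lemma pmulA : associative pmul.
Proof.
move=> g h k; rewrite -[g]pclassK -[h]pclassK -[k]pclassK.
by rewrite !pmulE catA.
Qed.

Lemma pmul1 : left_id pone pmul.
Proof. by move=> g; rewrite -[g]pclassK pmulE. Qed.

Lemma pmulr1 : right_id pone pmul.
Proof. by move=> g; rewrite -[g]pclassK pmulE cats0. Qed.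

Lemma pmulV : left_inverse pone pinv pmul.
Proof.
move=> g; rewrite -[g]pclassK pinvE pmulE.
by apply/pclassP; apply: wcong_mulVl.
Qed.

Lemma pmulrV : right_inverse pone pinv pmul.
Proof.
move=> g; rewrite -[g]pclassK pinvE pmulE.
by apply/pclassP; apply: wcong_mulV.
Qed.

HB.instance Definition _ :=
  isGroup.Build presented pmulA pmul1 pmulr1 pmulV pmulrV.

Definition pgen (a : S) : presented := pclass [:: (a, false)].

Lemma weval_pgen (w : word S) : weval pgen w = pclass w.
Proof.
elim: w => [|[a b] w IHw]; first by rewrite /weval big_nil.
rewrite /weval big_cons -/(weval pgen w) IHw /= -cat1s -[RHS]pmulE.
by case: b; rewrite // -[LHS]/(pmul (pinv _) _) pinvE.
Qed.

Lemma presented_rel u v : R u v -> weval pgen u = weval pgen v.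
Proof. by move=> Ruv; rewrite !weval_pgen; apply/pclassP/wcong_rel. Qed.

(* Well-definedness of the induced morphism from the presented group to H. *)
Lemma presented_lift (H : groupType) (f : S -> H) :
  (forall u v, R u v -> weval f u = weval f v) ->
  forall u v, pclass u = pclass v -> weval f u = weval f v.
Proof.
move=> fR u v /pclassP; elim=> {u v}.
- exact: fR.
- move=> [a b]; rewrite /weval !big_cons !big_nil /= mulg1.
  by case: b; rewrite /= ?mulVg ?mulgV.
- by move=> u u' v v' _ IHu _ IHv; rewrite /weval !big_cat /=; congr (_ * _).
- by [].
- by move=> u v _ ->.
- by move=> v u w _ -> _ ->.
Qed.

End Presentation.

(* A two-letter alphabet, used both for {x, y} and for {s_1, s_2}. *)
Variant alph2 := L1 | L2.

Definition bool_of_alph2 a := if a is L1 then true else false.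
Definition alph2_of_bool b := if b then L1 else L2.
Lemma bool_of_alph2K : cancel bool_of_alph2 alph2_of_bool.
Proof. by case. Qed.

HB.instance Definition _ := Choice.copy alph2 (can_type bool_of_alph2K).

Section Gmn.

Variables m n : nat.

Definition Grel (u v : word alph2) : Prop :=
  u = nseq m (L1, false) /\ v = nseq n (L2, false).

(* G_{m,n} = < x, y | x^m = y^n > *)
Definition Gmn : Type := presented Grel.

HB.instance Definition _ := Group.on Gmn.

Definition gx : Gmn := pgen Grel L1.
Definition gy : Gmn := pgen Grel L2.

Lemma weval_nseq (S : Type) (G : groupType) (f : S -> G) k a :
  weval f (nseq k (a, false)) = f a ^+ k.
Proof.
elim: k => [|k IHk]; first by rewrite /weval big_nil expg0.
by rewrite /weval big_cons -/(weval f _) IHk expgS.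
Qed.

Lemma Gmn_rel : gx ^+ m = gy ^+ n.
Proof. by rewrite -!weval_nseq; apply: presented_rel. Qed.

Definition s1 : Gmn := gx * gy * gx ^- m.-1.
Definition s2 : Gmn := gx ^+ m.-1 * gy^-1.

Definition sgen (a : alph2) : Gmn := if a is L1 then s1 else s2.

Definition s1_positive_word (w : word alph2) : Prop :=
  ((L1, false) \in w) && ((L1, true) \notin w).

(* The positive cone of <_D. *)
Definition D_positive (g : Gmn) : Prop :=
  (exists2 w, s1_positive_word w & g = weval sgen w) \/
  (exists2 k : nat, (1 <= k)%N & g = s2 ^+ k).

(* A left-invariant order is recovered from its positive cone by
   g < h iff 1 < g^-1 h. *)
Definition ltD (g h : Gmn) : Prop := D_positive (g^-1 * h).

End Gmn.

Arguments s1 {m n}.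
Arguments s2 {m n}.

Notation "g <_D h" := (ltD g h) (at level 70, no associativity) : group_scope.

(* Main.v *)
From Corelib Require Import Setoid.
Require Import Defs.
From mathcomp Require Import all_boot.
From mathcomp Require Import ssralg ssrint zify.

(** Write x and y for the generators and z = x^m = y^n, which is central.  Then
    x = s1 s2 and s2 y = x^(m-1), so x and y belong to the submonoid generated
    by s1, s2 and the inverse of s2, that is, to the elements that have a word
    without the inverse of s1.  Let g <=_D h mean that g^-1 h lies in this
    submonoid; this is reflexive, transitive and invariant under left
    multiplication, and it cannot tell g from g s2, so it compares cosets of
    the cyclic group generated by s2.  Geometrically these cosets are points of
    a line on which the group acts by increasing maps, s2 fixes the base point
    1, and
      1 <= y <= ... <= y^(n-1) = x <= x^2 <= ... <= x^(m-1) <= x^m = z,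
    where y^(n-1) and x are the same point because x s2 = y^(n-1).

    The core of the proof is that s2 moves every point g forward, g <=_D s2 g
    ([s2_up_all]).  If g lies between y and x^(m-1), then
    g <= x^(m-1) = s2 y <= s2 g ([s2_up_middle]).  Near the ends of the
    fundamental interval from 1 to z this fails, and a ping-pong argument on
    the normal form of g in the amalgam takes over: up to the centre, g is an
    alternating product of powers of x and y.  A product that begins with a
    power of x lies between x and z, one that begins with a power of y lies
    between 1 and x, and prepending one more syllable leads into the middle
    part, except for the syllables y and x^(m-1).  Since s2 y = x^(m-1), these
    two can be traded for a power of the other generator without changing
    whether the point moves forward; the trade merges syllables, which leaves
    points already treated ([x_window_up_mul] and [y_window_up_mul]).

    Hence g^-1 s2 g has a word w without the inverse of s1.  If s1 occurs in w,
    the element is positive.  Otherwise g^-1 s2 g is a power of s2, and the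
    homomorphism to the integers with x of degree n and y of degree m gives s2
    the degree mn - m - n, which vanishes only for m = n = 2; comparing degrees
    shows that the power is s2 itself. *)

Set Implicit Arguments.
Unset Strict Implicit.
Unset Printing Implicit Defensive.

Local Open Scope group_scope.

Lemma weval_cat (S : Type) (G : groupType) (f : S -> G) (u v : word S) :
  weval f (u ++ v) = weval f u * weval f v.
Proof. by rewrite /weval big_cat. Qed.

Lemma mulV_expg (G : groupType) (g : G) i j :
  g^-1 * (g ^+ i * g ^- j) = g ^+ i * g ^- j.+1.
Proof.
have gi : commute g^-1 (g ^+ i).
  exact/commuteX/commute_sym/commuteV/commute_refl.
by rewrite mulgA gi -mulgA expgSr invgM.
Qed.

(** * The weak order defined by the words without the inverse of s1 *)

Section WeakOrder.

Variables m n : nat.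
Implicit Types (c g h k u v : Gmn m n) (i j : nat).

Local Notation x := (gx m n).
Local Notation y := (gy m n).
Local Notation s1 := (@s1 m n).
Local Notation s2 := (@s2 m n).

Definition s1_nonneg g :=
  exists2 w, (L1, true) \notin w & g = weval (@sgen m n) w.

Definition leD g h := s1_nonneg (g^-1 * h).

Local Notation "g <=_D h" := (leD g h) (at level 70, no associativity).

Lemma s1_nonneg1 : s1_nonneg 1.
Proof. by exists [::] => //; rewrite /weval big_nil. Qed.

Lemma s1_nonnegM g h : s1_nonneg g -> s1_nonneg h -> s1_nonneg (g * h).
Proof.
move=> [u nu ->] [v nv ->]; exists (u ++ v); last by rewrite weval_cat.
by rewrite mem_cat negb_or nu nv.
Qed.

Lemma s1_nonnegX g i : s1_nonneg g -> s1_nonneg (g ^+ i).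
Proof.
move=> Mg; elim: i => [|i IHi]; first by rewrite expg0; apply: s1_nonneg1.
by rewrite expgS; apply: s1_nonnegM.
Qed.

Lemma s1_nonneg_s1 : s1_nonneg s1.
Proof. by exists [:: (L1, false)] => //; rewrite /weval big_seq1. Qed.

Lemma s1_nonneg_s2 : s1_nonneg s2.
Proof. by exists [:: (L2, false)] => //; rewrite /weval big_seq1. Qed.

Lemma s1_nonneg_s2V : s1_nonneg s2^-1.
Proof. by exists [:: (L2, true)] => //; rewrite /weval big_seq1. Qed.

Lemma leD_refl g : g <=_D g.
Proof. by rewrite /leD mulVg; apply: s1_nonneg1. Qed.

Lemma leD_trans h g k : g <=_D h -> h <=_D k -> g <=_D k.
Proof.
move=> gh hk; rewrite /leD -[k](mulVKg h) mulgA.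
exact: s1_nonnegM.
Qed.

Lemma leD_mul2l k g h : k * g <=_D k * h <-> g <=_D h.
Proof. by rewrite /leD invgM -mulgA mulKg. Qed.

Lemma leD_mulr g h : s1_nonneg h -> g <=_D g * h.
Proof. by rewrite /leD mulKg. Qed.

Lemma leD_exp g i j : s1_nonneg g -> (i <= j)%N -> g ^+ i <=_D g ^+ j.
Proof.
by move=> Mg ij; rewrite -(subnKC ij) expgnDr; apply/leD_mulr/s1_nonnegX.
Qed.

Lemma x_s1s2 : x = s1 * s2.
Proof. by rewrite /s1 /s2 mulgA mulgVK mulgK. Qed.

Lemma s2y : s2 * y = x ^+ m.-1.
Proof. by rewrite /s2 mulgVK. Qed.

Lemma s1_nonneg_x : s1_nonneg x.
Proof.
rewrite x_s1s2; exact: s1_nonnegM s1_nonneg_s1 s1_nonneg_s2.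
Qed.

Lemma s1_nonneg_y : s1_nonneg y.
Proof.
rewrite -[y](mulKg s2) s2y.
exact: s1_nonnegM s1_nonneg_s2V (s1_nonnegX _ s1_nonneg_x).
Qed.

(** * Central elements *)

(** Positions of points are described up to an arbitrary central factor, which
    avoids keeping track of integer powers of z. *)
Definition central c := forall g, c * g = g * c.

Lemma central1 : central 1.
Proof. by move=> g; rewrite mul1g mulg1. Qed.

Lemma centralM c d : central c -> central d -> central (c * d).
Proof. by move=> cc cd g; rewrite -mulgA cd mulgA (cc g) mulgA. Qed.

Lemma centralV c : central c -> central c^-1.
Proof. by move=> cc g; apply: (mulgI c); rewrite mulVKg mulgA cc mulgK. Qed.

(** * Moving forward under s2 *)

(** The point g moves forward under s2.  The property is invariant under left
    multiplication by s2 and by central elements. *)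
Definition s2_up g := g <=_D s2 * g.

Lemma s2_up_s2 g : s2_up (s2 * g) <-> s2_up g.
Proof. exact: leD_mul2l. Qed.

Lemma s2_up_central c g : central c -> s2_up (c * g) <-> s2_up g.
Proof. by move=> cc; rewrite /s2_up mulgA -cc -mulgA; apply: leD_mul2l. Qed.

Lemma s2_up1 : s2_up 1.
Proof. by rewrite /s2_up mulg1 -[s2]mul1g; apply/leD_mulr/s1_nonneg_s2. Qed.

(** The image of the whole middle part, which begins at y, lies beyond its end:
    c g <= x^(m-1) = s2 y <= s2 c g. *)
Lemma s2_up_middle c g :
  central c -> y <=_D c * g -> c * g <=_D x ^+ m.-1 -> s2_up g.
Proof.
move=> cc ycg cgx; apply/(s2_up_central g cc); apply: leD_trans cgx _.
by rewrite -s2y; apply/leD_mul2l.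
Qed.

Hypotheses (m_gt1 : (1 < m)%N) (n_gt1 : (1 < n)%N).

Local Notation z := (x ^+ m).

(** By this identity x and y^(n-1) represent the same point, which joins the
    chain of powers of y to the chain of powers of x. *)
Lemma x_yn_s2 : x * s2 = y ^+ n.-1.
Proof.
rewrite /s2 mulgA -expgS prednK 1?ltnW // Gmn_rel.
have -> : y ^+ n = y ^+ n.-1 * y by rewrite -expgSr prednK 1?ltnW.
by rewrite mulgK.
Qed.

Lemma leD_yn_x : y ^+ n.-1 <=_D x.
Proof.
rewrite -[X in _ <=_D X](mulgK s2) x_yn_s2.
exact/leD_mulr/s1_nonneg_s2V.
Qed.

Lemma leD_x_exp i j : (i <= j)%N -> x ^+ i <=_D x ^+ j.
Proof. exact/leD_exp/s1_nonneg_x. Qed.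

Lemma leD_y_exp i j : (i <= j)%N -> y ^+ i <=_D y ^+ j.
Proof. exact/leD_exp/s1_nonneg_y. Qed.

Lemma leD_yx i j : (i < n)%N -> (0 < j)%N -> y ^+ i <=_D x ^+ j.
Proof.
move=> ilt j0; apply: (@leD_trans (y ^+ n.-1)).
  by apply: leD_y_exp; lia.
by apply: (leD_trans leD_yn_x); apply: (@leD_x_exp 1).
Qed.

Lemma central_z : central z.
Proof.
have zx : commute z x by exact/commute_sym/commuteX/commute_refl.
have zy : commute z y by rewrite Gmn_rel; exact/commute_sym/commuteX/commute_refl.
move=> g; rewrite -[g]pclassK -weval_pgen /weval.
apply: commute_prod => -[[] []] _ //=; exact: commuteV.
Qed.

(** * Ping-pong *)

(** The induction invariant for products that begin with a power of x.  Besides the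
    position, it records that all translates by powers of y move forward, because
    this covers the exceptional syllables one step later. *)
Definition x_window_up g :=
  (exists2 c, central c & x <=_D c * g /\ c * g <=_D z) /\
  (forall j, (j < n)%N -> s2_up (y ^+ j * g)).

(** The invariant with the two generators exchanged. *)
Definition y_window_up g :=
  (exists2 c, central c & 1 <=_D c * g /\ c * g <=_D x) /\
  (forall i, (i < m)%N -> s2_up (x ^+ i * g)).

Lemma zV_yx j : (0 < j)%N -> y ^+ j.-1 <=_D z^-1 * (y ^+ j * x).
Proof.
case: j => // j _; rewrite -(leD_mul2l z) mulVKg.
rewrite Gmn_rel -expgnDr (_ : (n + j = j.+1 + n.-1)%N); last by lia.
by rewrite expgnDr; apply/leD_mul2l/leD_yn_x.
Qed.

(** As x and y^(n-1) are the same point, y^j carries the window from x to z onto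
    the one from z y^(j-1) to z y^j; the factor z^-1 brings it back. *)
Lemma mul_y_window c g j : central c -> (0 < j)%N ->
  x <=_D c * g -> c * g <=_D z ->
  y ^+ j.-1 <=_D z^-1 * c * (y ^+ j * g) /\
  z^-1 * c * (y ^+ j * g) <=_D y ^+ j.
Proof.
move=> cc j0 xg gz.
have -> : z^-1 * c * (y ^+ j * g) = z^-1 * (y ^+ j * (c * g)).
  by rewrite -mulgA (mulgA c) (cc (y ^+ j)) -mulgA.
split.
  apply: leD_trans (zV_yx j0) _; do 2 apply/leD_mul2l; exact: xg.
rewrite -(leD_mul2l z) mulVKg central_z; exact/leD_mul2l.
Qed.

Lemma mul_x_window c g i : central c ->
  1 <=_D c * g -> c * g <=_D x ->
  x ^+ i <=_D c * (x ^+ i * g) /\ c * (x ^+ i * g) <=_D x ^+ i.+1.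
Proof.
move=> cc g1 gx; rewrite (mulgA c) (cc (x ^+ i)) -mulgA; split.
  by rewrite -[X in X <=_D _]mulg1; apply/leD_mul2l.
by rewrite expgSr; apply/leD_mul2l.
Qed.

(** Prepending y^j with j >= 2 to x^i g lands in the middle part.  For j = 1 the
    relation s2 y = x^(m-1) turns y x^i g into z x^(i-1) g, which is covered by
    the invariant of g. *)
Lemma x_window_up_mul g i :
  (0 < i < m)%N -> y_window_up g -> x_window_up (x ^+ i * g).
Proof.
move=> /andP[i0 im] [[c cc [g1 gx]] up].
have [lo hi] := mul_x_window i cc g1 gx.
have xlo : x <=_D c * (x ^+ i * g).
  exact: (leD_trans (@leD_x_exp 1 _ i0) lo).
have hiz : c * (x ^+ i * g) <=_D z by exact: leD_trans hi (leD_x_exp im).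
split; first by exists c.
case=> [|[|j]] jn; first by rewrite mul1g; apply: up.
  rewrite expg1; apply/s2_up_s2; rewrite mulgA s2y mulgA -expgnDr.
  (* One factor x of x^i completes x^(m-1) to the central element z. *)
  have -> : (m.-1 + i = m + i.-1)%N by lia.
  by rewrite expgnDr -mulgA s2_up_central; [apply: up; lia|apply: central_z].
have [lo' hi'] := mul_y_window cc (ltn0Sn j.+1) xlo hiz.
apply: (s2_up_middle (centralM (centralV central_z) cc)).
  exact: leD_trans (@leD_y_exp 1 _ (ltn0Sn j)) lo'.
by apply: leD_trans hi' (leD_yx jn _); lia.
Qed.

(** Prepending x^i with 0 < i < m-1 to y^j g lands in the middle part.  For
    i = m-1 the relation x^(m-1) = s2 y turns the product into s2 y^(j+1) g, which
    is covered by the invariant of g. *)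
Lemma y_window_up_mul g j :
  (0 < j < n)%N -> x_window_up g -> y_window_up (y ^+ j * g).
Proof.
move=> /andP[j0 jn] [[c cc [gx gz]] up].
have [lo hi] := mul_y_window cc j0 gx gz.
have cc' := centralM (centralV central_z) cc.
have hix : z^-1 * c * (y ^+ j * g) <=_D x.
  exact: leD_trans hi (@leD_yx j 1 jn isT).
have lo1 : 1 <=_D z^-1 * c * (y ^+ j * g).
  exact: leD_trans (@leD_y_exp 0 _ (leq0n _)) lo.
split; first by exists (z^-1 * c).
case=> [|i] im; first by rewrite mul1g; apply: up.
have [im1|im1] := eqVneq i.+1 m.-1.
  rewrite im1 -s2y -mulgA s2_up_s2 mulgA -expgS.
  have [->|jn1] := eqVneq j.+1 n; last by apply: up; lia.
  (* Here y^(j+1) = y^n is central and disappears. *)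
  rewrite -Gmn_rel s2_up_central; last exact: central_z.
  by rewrite -[g]mul1g; apply: (up 0); lia.
have [lo' hi'] := mul_x_window i.+1 cc' lo1 hix.
apply: (s2_up_middle cc').
  exact: leD_trans (@leD_yx 1 i.+1 n_gt1 isT) lo'.
by apply: leD_trans hi' (leD_x_exp _); lia.
Qed.

Lemma y_window_up1 : y_window_up 1.
Proof.
split.
  exists 1; first exact: central1.
  by rewrite mulg1; split; [apply: leD_refl|apply: (@leD_x_exp 0 1)].
case=> [|i] im.
  by rewrite mulg1; apply: s2_up1.
rewrite mulg1; apply/(s2_up_middle central1).
  by rewrite mul1g; apply: (@leD_yx 1).
by rewrite mul1g; apply: leD_x_exp; lia.
Qed.

Lemma x_window_up1 : x_window_up 1.
Proof.
split.
  exists z; first exact: central_z.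
  by rewrite mulg1; split; [apply: (@leD_x_exp 1); lia|apply: leD_refl].
case=> [|j] jn.
  by rewrite mulg1; apply: s2_up1.
rewrite mulg1; apply/(s2_up_middle central1).
  by rewrite mul1g; apply: (@leD_y_exp 1).
by rewrite mul1g; apply: leD_yx; lia.
Qed.

(** * Normal forms *)

Definition other_gen a := if a is L1 then L2 else L1.
Definition gen_of a := if a is L1 then x else y.
Definition exponent_of a := if a is L1 then m else n.

(** Normal forms in the quotient by the centre, a free product of two cyclic
    groups.  The letter is that of the first syllable; the empty product counts
    for both letters. *)
Inductive alternating : alph2 -> Gmn m n -> Prop :=
| alternating1 a : alternating a 1
| alternatingM a i g : (0 < i < exponent_of a)%N -> alternating (other_gen a) g ->
    alternating a (gen_of a ^+ i * g).

Definition normalizable g :=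
  exists c a, central c /\ alternating a (c * g).

Lemma alternating_window_up a g :
  alternating a g -> if a is L1 then x_window_up g else y_window_up g.
Proof.
elim=> {a g} [[]|[] i g]; [exact: x_window_up1|exact: y_window_up1| |] => /= ib _ IH.
  exact: x_window_up_mul.
exact: y_window_up_mul.
Qed.

Lemma gen_of_exponent a : gen_of a ^+ exponent_of a = z.
Proof. by case: a => //=; rewrite Gmn_rel. Qed.

Lemma exponent_gt1 a : (1 < exponent_of a)%N. Proof. by case: a. Qed.

Lemma normalizable_central c g :
  central c -> normalizable g -> normalizable (c * g).
Proof.
move=> cc [d [a [cd ag]]]; exists (d * c^-1), a.
by split; [apply/centralM/centralV|rewrite -mulgA mulKg].
Qed.

Lemma normalizable_gen a g : normalizable g -> normalizable (gen_of a * g).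
Proof.
move=> [c [b [cc bg]]].
have -> : gen_of a * g = c^-1 * (gen_of a * (c * g)).
  by rewrite (mulgA (gen_of a)) -(cc (gen_of a)) -mulgA mulKg.
move: bg; move: (c * g) => {}g bg.
apply: normalizable_central; first exact: centralV.
have start h : alternating (other_gen a) h -> normalizable (gen_of a * h).
  move=> ah; exists 1, a; split; first exact: central1.
  by rewrite mul1g -[gen_of a]expg1; apply: alternatingM => //; apply: exponent_gt1.
case: bg start => {b g} [b|b i g ib bg] start; first exact/start/alternating1.
have [ab|ab] : a = b \/ other_gen a = b by case: (a) (b) => -[]; auto.
  subst b; rewrite mulgA -expgS.
  have [->|ia] := eqVneq i.+1 (exponent_of a).
    rewrite gen_of_exponent; apply: normalizable_central; first exact: central_z.
    by exists 1, (other_gen a); split; [apply: central1|rewrite mul1g].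
  exists 1, a; split; first exact: central1.
  by rewrite mul1g; apply: alternatingM => //; lia.
by apply: start; rewrite ab; apply: alternatingM.
Qed.

(** Up to the centre, a generator is inverted by a positive power of it. *)
Lemma normalizable_genV a g : normalizable g -> normalizable ((gen_of a)^-1 * g).
Proof.
move=> ng.
have -> : (gen_of a)^-1 * g = z^-1 * (gen_of a ^+ (exponent_of a).-1 * g).
  rewrite -(gen_of_exponent a).
  have -> : gen_of a ^+ exponent_of a = gen_of a ^+ (exponent_of a).-1 * gen_of a.
    by rewrite -expgSr prednK // ltnW // exponent_gt1.
  by rewrite invgM -!mulgA mulKg.
apply: normalizable_central; first exact/centralV/central_z.
elim: (exponent_of a).-1 => [|i IHi]; first by rewrite mul1g.
by rewrite expgS -mulgA; apply: normalizable_gen.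
Qed.

Lemma normalizableP g : normalizable g.
Proof.
rewrite -[g]pclassK -weval_pgen; elim: (repr g) => {g} [|[a b] w IHw].
  rewrite /weval big_nil; exists 1, L1.
  by split; [apply: central1|rewrite mul1g; apply: alternating1].
rewrite /weval big_cons -/(weval _ w) /=.
have -> : pgen (Grel m n) a = gen_of a by case: a.
by case: b; [apply: normalizable_genV|apply: normalizable_gen].
Qed.

(** The invariants contain the statement for g itself as the case of exponent 0. *)
Lemma s2_up_all g : s2_up g.
Proof.
have [c [a [cc /alternating_window_up]]] := normalizableP g.
case: a => -[_ /(_ 0%N)]; rewrite mul1g s2_up_central //; apply; lia.
Qed.

End WeakOrder.

(** * The degree map to the integers *)

Section Degree.

Variables m n : nat.
Implicit Types (g h : Gmn m n) (i j : nat).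

Local Notation s2 := (@s2 m n).

Definition letter_degree (a : alph2 * bool) : int :=
  let d := if a.1 is L1 then Posz n else Posz m in if a.2 then (- d)%R else d.

(** The exponent sum in which x counts n and y counts m, the weights that
    make the defining relation homogeneous. *)
Definition word_degree (w : word alph2) : int :=
  (\sum_(a <- w) letter_degree a)%R.

Definition degree g : int := word_degree (repr g).

Lemma word_degree_cat (u v : word alph2) :
  word_degree (u ++ v) = (word_degree u + word_degree v)%R.
Proof. by rewrite /word_degree big_cat. Qed.

Lemma word_degree_nseq a i :
  word_degree (nseq i a) = (letter_degree a * i%:Z)%R.
Proof.
elim: i => [|i IHi]; first by rewrite /word_degree big_nil; lia.
by rewrite /word_degree big_cons -/(word_degree _) IHi; lia.
Qed.

Lemma word_degree_wcong (u v : word alph2) :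
  wcong (Grel m n) u v -> word_degree u = word_degree v.
Proof.
elim=> {u v} [u v [-> ->]|a|u u' v v' _ IHu _ IHv|//|//|u v w _ -> _ -> //].
- by rewrite !word_degree_nseq /letter_degree /=; lia.
- rewrite /word_degree !big_cons !big_nil /letter_degree /linv /=.
  by case: a => -[] [] /=; lia.
- by rewrite !word_degree_cat IHu IHv.
Qed.

Lemma degree_pclass (w : word alph2) :
  degree (pclass (Grel m n) w) = word_degree w.
Proof. exact/word_degree_wcong/reprP. Qed.

Lemma degreeM g h : degree (g * h) = (degree g + degree h)%R.
Proof.
rewrite /degree -word_degree_cat; exact: degree_pclass.
Qed.

Lemma degree1 : degree 1 = 0%R.
Proof. by have := degreeM 1 1; rewrite mulg1; lia. Qed.

Lemma degreeV g : degree g^-1 = (- degree g)%R.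
Proof. by have := degreeM g g^-1; rewrite mulgV degree1; lia. Qed.

Lemma degreeX g i : degree (g ^+ i) = (degree g * i%:Z)%R.
Proof.
elim: i => [|i IHi]; first by rewrite expg0 degree1; lia.
by rewrite expgS degreeM IHi; lia.
Qed.

Lemma degree_s2 : degree s2 = (n%:Z * m.-1%:Z - m%:Z)%R.
Proof.
rewrite degreeM degreeX degreeV !degree_pclass /word_degree !big_seq1.
by rewrite /letter_degree /=; lia.
Qed.

Lemma mulB_eq1 (d e : int) i j :
  (- e + (d + e) = d * i%:Z - d * j%:Z)%R -> d <> 0%R -> i = j.+1.
Proof.
move=> eqd /eqP d0; have /eqP : (d * (i%:Z - j%:Z - 1) = 0)%R by lia.
by rewrite GRing.mulf_eq0 (negPf d0) => /eqP; lia.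
Qed.

Lemma degree_s2_neq0 :
  (1 < m)%N -> (1 < n)%N -> (m, n) <> (2, 2) -> degree s2 <> 0%R.
Proof.
move=> m_gt1 n_gt1 h22 /eqP; rewrite degree_s2 => /eqP eq0; apply: h22.
have : (n * m.-1 = m)%N by lia.
case: m m_gt1 {eq0} => [|[|k]] //= _ eqn.
have k0 : k = 0%N by nia.
by subst k; congr (_, _); lia.
Qed.

Lemma s2_word (w : word alph2) :
    (L1, false) \notin w -> (L1, true) \notin w ->
  exists i j, weval (@sgen m n) w = s2 ^+ i * s2 ^- j.
Proof.
elim: w => [|[a b] w IHw]; first by exists 0%N, 0%N; rewrite /weval big_nil mulgV.
rewrite !inE !negb_or => /andP[ab wf] /andP[ab' wt].
have {ab ab'} -> : a = L2 by move: ab ab'; case: a b => -[].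
have [i [j eqw]] := IHw wf wt.
rewrite /weval big_cons -/(weval _ w) eqw /=; case: b.
  by exists i, j.+1; apply: mulV_expg.
by exists i.+1, j; rewrite expgS mulgA.
Qed.

End Degree.

Theorem theorem7 (m n : nat) (hn : (2 <= n)%N) (hmn : (n <= m)%N)
    (h22 : (m, n) <> (2, 2)) (g : Gmn m n) :
  g <_D s2 * g.
Proof.
have hm := leq_trans hn hmn.
have [w wV eqw] := s2_up_all hm hn g.
have [s1w|s1w] := boolP ((L1, false) \in w).
  by left; exists w; rewrite /s1_positive_word ?s1w.
right; exists 1%N => //; move: eqw.
have [i [j ->]] := s2_word m n s1w wV; rewrite expg1 => eqg.
have eqd : (- degree g + (degree (@s2 m n) + degree g)
            = degree (@s2 m n) * i%:Z - degree (@s2 m n) * j%:Z)%R.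
  by rewrite -!degreeX -!degreeV -!degreeM eqg.
have ij := mulB_eq1 eqd (degree_s2_neq0 hm hn h22).
by rewrite eqg ij expgS mulgK.
Qed.
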